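(* Let $n$ be a positive integer and let $k$ be a positive integer such that $k$ divides $n$ and $n$ divides $k^2$. Define $l:=n-\frac{k^2}{n}$. Then the generic completion rank of $G(n,l)$ is $n-\sqrt{n^2-nl}=n-k$.
   Context: $G(n,l)$ denotes the bipartite graph whose parts $A$ and $B$ are disjoint copies of $[n]=\{1,\dots,n\}$, where each $i\in A$ is adjacent to all vertices of $B$ except $i,i+1,\dots,i+n-l-1$ (indices taken modulo $n$). For a bipartite graph $G=([m],[n],E)$ with $E\subseteq[m]\times[n]$, a $G$-partial matrix over $\mathbb{C}$ is a vector $M\in\mathbb{C}^E$; a completion of $M$ is an $m\times n$ complex matrix $A$ with $A_{ij}=M_{ij}$ for all $(i,j)\in E$; the complex completion rank of $M$ is the smallest rank of a completion. The generic completion rank of $G$ is the unique integer that is the complex completion rank of all $M$ in some nonempty Zariski-open subset of $\mathbb{C}^E$. *)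

(* Defs.v *)
From mathcomp Require Import all_boot all_order all_algebra.
From mathcomp Require Import mpoly.

Set Implicit Arguments.
Unset Strict Implicit.
Unset Printing Implicit Defensive.

Import GRing.Theory.
Local Open Scope ring_scope.

(* The paper's [n] is {1, ..., n}; here vertices are numbered from 0, which
   leaves the relation unchanged up to relabelling both parts by i |-> i - 1,
   since it only involves j - i mod n. Meaningful for l <= n. *)
Definition Gnl (n l : nat) : {set 'I_n * 'I_n} :=
  [set e : 'I_n * 'I_n | ~~ [exists t : 'I_(n - l), e.2 == ((e.1 + t) %% n)%N :> nat]].

(* A bipartite graph ([m], [n], E) is given by its edge set E. *)
Definition edge (m n : nat) (E : {set 'I_m * 'I_n}) : finType :=
  {e : 'I_m * 'I_n | e \in E}.

Definition partial_matrix (K : fieldType) (m n : nat)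
  (E : {set 'I_m * 'I_n}) : Type := {ffun edge E -> K}.

Definition completion (K : fieldType) (m n : nat) (E : {set 'I_m * 'I_n})
    (M : partial_matrix K E) (A : 'M[K]_(m, n)) : Prop :=
  forall e : edge E, A (val e).1 (val e).2 = M e.

Definition is_completion_rank (K : fieldType) (m n : nat)
    (E : {set 'I_m * 'I_n}) (M : partial_matrix K E) (r : nat) : Prop :=
  (exists A, completion M A /\ \rank A = r) /\
  (forall A, completion M A -> (r <= \rank A)%N).

(* Zariski-open subsets of K^E are complements of common zero sets of families
   of polynomials; the variable with index i stands for the coordinate of the
   edge enum_val i. *)
Definition zariski_open (K : fieldType) (m n : nat) (E : {set 'I_m * 'I_n})
    (U : partial_matrix K E -> Prop) : Prop :=
  exists S : {mpoly K[#|edge E|]} -> Prop,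
    forall M, U M <-> exists2 p, S p & p.@[fun i => M (enum_val i)] != 0.

Definition is_generic_completion_rank (K : fieldType) (m n : nat)
    (E : {set 'I_m * 'I_n}) (r : nat) : Prop :=
  unique (fun s : nat => exists U : partial_matrix K E -> Prop,
    [/\ zariski_open U, exists M, U M
      & forall M, U M -> is_completion_rank M s]) r.

(* Main.v *)
Require Import Defs.
From mathcomp Require Import all_boot all_order all_algebra.
From mathcomp Require Import reals complex.
From mathcomp Require Import closed_field mpoly zify ring.
From mathcomp Require boolp.

Set Implicit Arguments.
Unset Strict Implicit.
Unset Printing Implicit Defensive.

Import GRing.Theory Num.Theory.
Local Open Scope ring_scope.

(** Write n = m * k; the divisibility n | k^2 then gives k = m * d and
n = m^2 * d, and each of the n rows has d = n - l unspecified entries, so that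
k^2 entries are unspecified altogether.  Completing a partial matrix to rank at
most n - k imposes k^2 conditions (the codimension of the variety of matrices
of corank k) on k^2 unknowns, and the point is that for this pattern the count
gives the truth.  Call a set of partial matrices thin if some nonzero polynomial
vanishes on it; a property is generic when its failures form a thin set, and
a rank that is the completion rank outside a thin set is the generic one because
the nonvanishing loci of two nonzero polynomials meet.

Lower bound: a matrix of rank s is a product D * A', where A' consists of s of
its rows and D has an identity block on these rows.  So the partial matrices
with a completion of rank s are covered by finitely many polynomial maps, one
for each choice of rows, in (n - s) s + s n = n^2 - (n - s)^2 parameters.  If
s < n - k this is less than n^2 - k^2, the number of specified entries, and the
image of a polynomial map with fewer parameters than coordinates is thin
([thin_image_few_params]), because counting monomials yields an algebraic
relation.

Upper bound: over an algebraically closed field, quantifier elimination shows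
that the image of a polynomial map is thin or has a thin complement
([image_thin_or_cothin]), and this applies to the set of partial matrices with
a completion of rank at most n - k.  It remains to see that this set is not
thin, for which it is enough to find one point from which curves inside the set
leave in every direction ([velocities_not_thin]).  At a product P * Q of inner
dimension n - k, where the rows of L span the left kernel of P and the columns
of R the right kernel of Q, the velocities of products of moving factors are
the X with L * X * R = 0 ([tangent_decomposition]).  Choose L and R to be the
incidence matrices of maps a and b from [n] to [k]: then L * X * R lists the
sums of X over the blocks {a = c, b = d}, and a direction prescribed on the
specified entries extends to a tangent one as soon as each block contains
exactly one unspecified position ([completable_not_thin]).  For the circulant
pattern this is achieved by a(i) = i mod k and
b(j) = d * floor(j / k) + j mod d ([Gnl_blocks]). *)

(** * Nonvanishing points of multivariate polynomials *)

Lemma digits_inj B n (f g : 'I_n -> nat) :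
  (forall i, f i < B)%N -> (forall i, g i < B)%N ->
  (\sum_i f i * B ^ i = \sum_i g i * B ^ i)%N -> f =1 g.
Proof.
elim: n f g => [|n IHn] f g fB gB; first by move=> _ [].
have split_head h : (\sum_(i < n.+1) h i * B ^ i =
    (\sum_(i < n) h (lift ord0 i) * B ^ i) * B + h ord0)%N.
  rewrite big_ord_recl expn0 muln1 addnC big_distrl; congr (_ + _)%N.
  by apply: eq_bigr => i _; rewrite /= -mulnA -expnSr.
rewrite !split_head => efg.
have e0 : f ord0 = g ord0.
  by have := congr1 (modn^~ B) efg; rewrite /= !modnMDl !modn_small.
have B_gt0 : (0 < B)%N := leq_ltn_trans (leq0n _) (fB ord0).
have/IHn e1 : (\sum_(i < n) f (lift ord0 i) * B ^ i =
               \sum_(i < n) g (lift ord0 i) * B ^ i)%N.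
  by move: efg; rewrite e0 => /addIn /eqP; rewrite eqn_pmul2r // => /eqP.
move=> i; case: (unliftP ord0 i) => [j|] -> //.
by apply: e1.
Qed.

Lemma horner_mmap (K : comNzRingType) n (h : 'I_n -> {poly K})
    (p : {mpoly K[n]}) t :
  (mmap (@polyC K) h p).[t] = p.@[fun i => (h i).[t]].
Proof.
rewrite mevalE /mmap horner_sum; apply: eq_bigr => m _.
rewrite hornerM hornerC /mmap1 horner_prod; congr (_ * _).
by apply: eq_bigr => i _; rewrite horner_exp.
Qed.

(** Kronecker substitution: sending the i-th variable to the power B^i of a
single one, with B above all exponents, keeps distinct monomials distinct, so a
nonzero polynomial becomes a nonzero univariate one. *)
Lemma mpoly_nonroot (K : closedFieldType) n (p : {mpoly K[n]}) :
  p != 0 -> exists x, p.@[x] != 0.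
Proof.
move=> p_neq0; pose B := msize p.
pose key (m : 'X_{1..n}) := (\sum_i m i * B ^ i)%N.
have small m : m \in msupp p -> forall i, (m i < B)%N.
  move=> /msize_mdeg_lt mB i; apply: leq_ltn_trans mB.
  by rewrite mdegE (bigD1 i) //= leq_addr.
pose q : {poly K} := mmap (@polyC K) (fun i => 'X^(B ^ i)) p.
have qE : q = \sum_(m <- msupp p) p@_m *: 'X^(key m).
  apply: eq_bigr => m _; rewrite -mul_polyC /mmap1 /key; congr (_ * _).
  rewrite -prodrXr; apply: eq_bigr => i _.
  by rewrite exprAC -exprM.
suff /closed_nonrootP[t] : q != 0.
  by rewrite /root horner_mmap => ?; eexists; eassumption.
have m0_in := mlead_supp p_neq0.
apply/eqP => /(congr1 (fun r : {poly K} => r`_(key (mlead p)))).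
rewrite coef0 qE coef_sum (big_rem _ m0_in) /= coefZ coefXn eqxx mulr1 big1_seq.
  by apply/eqP; rewrite addr0 -mcoeff_msupp.
move=> m /= m_in; rewrite coefZ coefXn.
case: eqP => [ekey|_]; last by rewrite mulr0.
suff em : mlead p = m by rewrite em mem_rem_uniqF ?msupp_uniq in m_in.
apply/mnmP; apply: (@digits_inj B) => //; apply/small => //.
exact: mem_rem m_in.
Qed.

(** * Thin sets and the image of a polynomial map *)

(** Thin means not Zariski-dense. *)
Definition thin (K : fieldType) N (S : ('I_N -> K) -> Prop) : Prop :=
  exists2 g : {mpoly K[N]}, g != 0 & forall y, S y -> g.@[y] = 0.

Lemma thin_sub (K : fieldType) N (S T : ('I_N -> K) -> Prop) :
  thin T -> (forall y, S y -> T y) -> thin S.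
Proof. by move=> [g g0 gT] sub; exists g => // y /sub/gT. Qed.

Lemma thin_exists (K : fieldType) N (I : finType)
    (S : I -> ('I_N -> K) -> Prop) :
  (forall i, thin (S i)) -> thin (fun y => exists i, S i y).
Proof.
move=> thinS.
have /fin_all_exists[g gP] i : exists g : {mpoly K[N]},
    g != 0 /\ forall y, S i y -> g.@[y] = 0.
  by case: (thinS i) => g; exists g.
exists (\prod_i g i); first by apply/prodf_neq0 => i _; case: (gP i).
move=> y [i Siy]; rewrite (bigD1 i) //= mevalM.
by case: (gP i) => _ ->; rewrite ?mul0r.
Qed.

Lemma thin_or (K : fieldType) N (S T : ('I_N -> K) -> Prop) :
  thin S -> thin T -> thin (fun y => S y \/ T y).
Proof.
move=> thinS thinT.
apply: (@thin_sub _ _ _ (fun y => exists b : bool, (if b then S else T) y)).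
  by apply: thin_exists => -[].
by move=> y []; [exists true | exists false].
Qed.

(** First-order formulas are evaluated in an environment that is a list: the
coordinates of a point occupy its first N variables. *)
Definition point_env (K : fieldType) N (y : 'I_N -> K) : seq K :=
  [seq y j | j <- enum 'I_N].

Lemma nth_point_env (K : fieldType) N (y : 'I_N -> K) (j : 'I_N) :
  (point_env y)`_j = y j.
Proof. by rewrite (nth_map j) ?size_enum_ord // nth_ord_enum. Qed.

(** The shift [s] lets the variables of a polynomial be quantified while the
variables below [s] stay free for the coordinates of a point. *)
Lemma mpoly_term (K : fieldType) P s (q : {mpoly K[P]}) :
  exists2 t : GRing.term K, GRing.rterm t &
    forall e, GRing.eval e t = q.@[fun i => e`_(s + i)].
Proof.
have mono (m : 'X_{1..P}) : exists2 t : GRing.term K, GRing.rterm t &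
    forall e, GRing.eval e t = \prod_(i < P) e`_(s + i) ^+ m i.
  rewrite /index_enum; elim: (Finite.enum _) => [|i r [t rt tP]].
    by exists (GRing.NatConst K 1) => // e; rewrite big_nil.
  exists (GRing.Mul (GRing.Exp (GRing.Var K (s + i)) (m i)) t) => //= e.
  by rewrite big_cons tP.
elim/mpolyind: q => [|c m p _ _ [t rt tP]].
  by exists (GRing.NatConst K 0) => // e; rewrite meval0.
have [u ru uP] := mono m.
exists (GRing.Add (GRing.Mul (GRing.Const c) u) t); first by rewrite /= ru.
by move=> e; rewrite mevalD mevalZ mevalX /= uP tP.
Qed.

Lemma term_mpoly (K : fieldType) N (t : GRing.term K) : GRing.rterm t ->
  exists q : {mpoly K[N]}, forall y, GRing.eval (point_env y) t = q.@[y].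
Proof.
elim: t => //=.
- move=> i _; have [iN|Ni] := ltnP i N.
    by exists 'X_(Ordinal iN) => y; rewrite mevalXU -nth_point_env.
  exists 0 => y; rewrite meval0 nth_default //.
  by rewrite size_map size_enum_ord.
- by move=> c _; exists c%:MP => y; rewrite mevalC.
- by move=> m _; exists (m%:R)%:MP => y; rewrite mevalC.
- move=> t IHt u IHu /andP[/IHt[p pP] /IHu[q qP]].
  by exists (p + q) => y; rewrite mevalD pP qP.
- by move=> t IHt /IHt[p pP]; exists (- p) => y; rewrite mevalN pP.
- by move=> t IHt m /IHt[p pP]; exists (p *+ m) => y; rewrite mevalMn pP.
- move=> t IHt u IHu /andP[/IHt[p pP] /IHu[q qP]].
  by exists (p * q) => y; rewrite mevalM pP qP.
- by move=> t IHt m /IHt[p pP]; exists (p ^+ m) => y; rewrite rmorphXn /= pP.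
Qed.

(** An atomic formula compares two polynomials: it is either always true or
false outside the zero locus of their difference.  Boolean connectives only
take unions of the exceptional sets. *)
Lemma qf_generically_constant (K : closedFieldType) N (f : GRing.formula K) :
  GRing.qf_form f -> GRing.rformula f ->
  exists b, thin (fun y : 'I_N -> K => GRing.qf_eval (point_env y) f <> b).
Proof.
have const (b : bool) : thin (fun y : 'I_N -> K => b <> b).
  by exists 1 => [|y []] //; apply: oner_neq0.
elim: f => //=.
- by move=> b _ _; exists b; apply: const.
- move=> t u _ /andP[/(@term_mpoly _ N)[p pP] /(@term_mpoly _ N)[q qP]].
  have [epq|npq] := eqVneq (p - q) 0.
    exists true; refine (thin_sub (const true) _) => y [].
    by rewrite pP qP -subr_eq0 -mevalB epq meval0 eqxx.
  exists false; exists (p - q) => // y.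
  by rewrite pP qP -subr_eq0 -mevalB; case: eqP.
- move=> f IHf g IHg /andP[qf qg] /andP[rf rg].
  have [b bP] := IHf qf rf; have [c cP] := IHg qg rg.
  exists (b && c); refine (thin_sub (thin_or bP cP) _) => y /= nbc.
  have [|] := GRing.qf_eval (point_env y) f =P b; last by auto.
  have [|] := GRing.qf_eval (point_env y) g =P c; last by auto.
  by move=> eg ef; rewrite ef eg in nbc.
- move=> f IHf g IHg /andP[qf qg] /andP[rf rg].
  have [b bP] := IHf qf rf; have [c cP] := IHg qg rg.
  exists (b || c); refine (thin_sub (thin_or bP cP) _) => y /= nbc.
  have [|] := GRing.qf_eval (point_env y) f =P b; last by auto.
  have [|] := GRing.qf_eval (point_env y) g =P c; last by auto.
  by move=> eg ef; rewrite ef eg in nbc.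
- move=> f IHf g IHg /andP[qf qg] /andP[rf rg].
  have [b bP] := IHf qf rf; have [c cP] := IHg qg rg.
  exists (b ==> c); refine (thin_sub (thin_or bP cP) _) => y /= nbc.
  have [|] := GRing.qf_eval (point_env y) f =P b; last by auto.
  have [|] := GRing.qf_eval (point_env y) g =P c; last by auto.
  by move=> eg ef; rewrite ef eg in nbc.
- move=> f IHf qf rf; have [b bP] := IHf qf rf.
  exists (~~ b); refine (thin_sub bP _) => y /= nb eb.
  by rewrite eb in nb.
Qed.

Lemma formula_generically_constant (K : closedFieldType) N
    (f : GRing.formula K) : GRing.rformula f ->
  thin (fun y : 'I_N -> K => GRing.holds (point_env y) f) \/
  thin (fun y : 'I_N -> K => ~ GRing.holds (point_env y) f).
Proof.
move=> rf; have closedK := @solve_monicpoly K.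
pose qe := GRing.quantifier_elim (@ClosedFieldQE.ex_elim K).
have wf := @ClosedFieldQE.wf_ex_elim K.
have ok := ClosedFieldQE.holds_ex_elim closedK.
have /andP[qfe rqe] := GRing.quantifier_elim_wf wf rf.
have qeP e := GRing.quantifier_elim_rformP wf ok e rf.
have [[] bP] := qf_generically_constant N qfe rqe; [right|left].
  by refine (thin_sub bP _) => y nf /qeP.
by refine (thin_sub bP _) => y /qeP ->.
Qed.

(** The generic form of Chevalley's theorem on constructible images: belonging
to the image is a first-order property, hence generically constant. *)
Lemma image_thin_or_cothin (K : closedFieldType) P N
    (F : 'I_N -> {mpoly K[P]})
    (image := fun y => exists x, forall j, (F j).@[x] = y j) :
  thin image \/ thin (fun y => ~ image y).
Proof.
have /fin_all_exists[T TP] (j : 'I_N) :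
    exists t : GRing.term K, GRing.rterm t /\
    forall e, GRing.eval e t = (F j).@[fun i => e`_(N + i)].
  by have [t] := mpoly_term N (F j); exists t.
pose body := foldr GRing.And (@GRing.Bool K true)
  [seq GRing.Equal (GRing.Var K (nat_of_ord j)) (T j) | j <- enum 'I_N].
have rbody : GRing.rformula body.
  rewrite /body; elim: (enum 'I_N) => //= j r ->.
  by case: (TP j) => ->.
have holds_body e : GRing.holds e body <->
    forall j : 'I_N, e`_j = (F j).@[fun i => e`_(N + i)].
  suff aux r : GRing.holds e (foldr GRing.And (@GRing.Bool K true)
      [seq GRing.Equal (GRing.Var K (nat_of_ord j)) (T j) | j <- r]) <->
      {in r, forall j : 'I_N, e`_j = (F j).@[fun i => e`_(N + i)]}.
    rewrite aux; split=> [h j|h j _]; last exact: h.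
    by apply: h; rewrite mem_enum.
  elim: r => [|j r IHr] /=; first by split.
  rewrite IHr; case: (TP j) => _ ->; split=> [[h1 h2] i|h].
    by rewrite inE => /predU1P[-> //|/h2].
  by split=> [|i ir]; apply: h; rewrite inE ?eqxx // ir orbT.
(* Variables below N are the target coordinates; the P next ones, bound here,
   are the source coordinates. *)
pose f := foldr (@GRing.Exists K) body (iota N P).
have rf : GRing.rformula f by rewrite /f; elim: (iota N P).
have fP y : GRing.holds (point_env y) f <-> image y.
  rewrite -GRing.foldExistsP; split=> [[e eqe /holds_body eP]|[x xP]].
    exists (fun i : 'I_P => e`_(N + i)) => j; rewrite -eP -nth_point_env.
    by rewrite eqe // !inE mem_iota leqNgt ltn_ord.
  exists (point_env y ++ point_env x).
    move=> i; rewrite !inE mem_iota negb_and -ltnNge -leqNgt => out.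
    rewrite /GRing.same_env nth_cat size_map size_enum_ord.
    case: ltnP out => //= leNi out.
    by rewrite !nth_default // size_map size_enum_ord // leq_subRL.
  apply/holds_body => j; rewrite nth_cat size_map size_enum_ord ltn_ord.
  rewrite nth_point_env -xP; apply: meval_eq => i.
  rewrite nth_cat size_map size_enum_ord ltnNge leq_addr /= addKn.
  by rewrite nth_point_env.
have [h|h] := formula_generically_constant N rf; [left|right].
  by refine (thin_sub h _) => y /fP.
by refine (thin_sub h _) => y nf /fP.
Qed.

(** * Images of maps with too few parameters *)

Lemma msize_prod_exp (K : fieldType) N P d D (F : 'I_N -> {mpoly K[P]})
    (a : 'I_N -> nat) :
  (forall j, msize (F j) <= d.+1)%N -> (forall j, a j <= D)%N ->
  (msize (\prod_j F j ^+ a j) <= (N * (D * d)).+1)%N.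
Proof.
move=> Fd aD.
have mulD (p q : {mpoly K[P]}) b c : (msize p <= b.+1 -> msize q <= c.+1 ->
    msize (p * q) <= (b + c).+1)%N.
  have [->|p0] := eqVneq p 0; first by rewrite mul0r msize0.
  have [->|q0] := eqVneq q 0; first by rewrite mulr0 msize0.
  move=> pb qc; rewrite msizeM //.
  by move: (msize p) (msize q) pb qc => sp sq; lia.
have expD (p : {mpoly K[P]}) b m : (msize p <= b.+1 ->
    msize (p ^+ m) <= (m * b).+1)%N.
  move=> pb; elim: m => [|m IHm]; first by rewrite expr0 msize1.
  by rewrite exprS mulSn; apply: mulD.
rewrite -[N in (N * _)%N]card_ord -sum_nat_const.
elim/big_rec2: _ => [|j b p _ IHp]; first by rewrite msize1.
apply: mulD IHp; apply: leq_trans (expD _ _ _ (Fd j)) _.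
by rewrite ltnS leq_mul2r aD orbT.
Qed.

(** There are D^N monomials in the coordinates with exponents below D; composed
with F they lie in a space of dimension at most (c D)^P, where c depends on F
only.  Since P < N, for large D there are more monomials than dimensions, and a
linear dependency among the compositions is a polynomial vanishing on the
image. *)
Lemma thin_image_few_params (K : fieldType) P N (F : 'I_N -> {mpoly K[P]}) :
  (P < N)%N -> thin (fun y => exists x, forall j, (F j).@[x] = y j).
Proof.
move=> ltPN.
pose d := (\max_j msize (F j))%N.
have Fd j : (msize (F j) <= d.+1)%N by apply: leqW; apply: leq_bigmax.
(* D is chosen so that (c * D) ^ P = c ^ P * D ^ P < D ^ P.+1. *)
pose c := (N * d).+1; pose D := (c ^ P).+1.
pose rowT := {ffun 'I_N -> 'I_D}; pose colT := {ffun 'I_P -> 'I_(c * D)}.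
have more_rows : (#|colT| < #|rowT|)%N.
  rewrite !card_ffun !card_ord; apply: (@leq_trans (D ^ P.+1)); last first.
    by rewrite leq_pexp2l.
  by rewrite expnMn expnS ltn_pmul2r // expn_gt0.
pose mon n B (a : {ffun 'I_n -> 'I_B}) := [multinom nat_of_ord (a i) | i < n].
pose q (a : rowT) := \prod_j F j ^+ a j.
pose A := \matrix_(r < #|rowT|, s < #|colT|)
  (q (enum_val r))@_(mon _ _ (enum_val s)).
have [v v0 vA] : exists2 v : 'rV[K]_#|rowT|, v != 0 & v *m A = 0.
  exists (nz_row (kermx A)); last by apply/sub_kermxP; apply: nz_row_sub.
  rewrite nz_row_eq0 kermx_eq0 /row_free neq_ltn.
  by rewrite (leq_ltn_trans (rank_leq_col A) more_rows).
have mon_inj n B : injective (@mon n B).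
  move=> a b /mnmP eab; apply/ffunP => i; apply: val_inj.
  by have := eab i; rewrite !mnmE.
exists (\sum_r v 0 r *: 'X_[mon _ _ (enum_val r)]).
  case/rV0Pn: v0 => r vr; apply: contraNneq vr.
  move/(congr1 (mcoeff (mon _ _ (enum_val r)))); rewrite mcoeff0 => <-.
  rewrite raddf_sum (bigD1 r) //= mcoeffZ mcoeffX eqxx mulr1 big1 ?addr0 //.
  move=> s nsr; rewrite mcoeffZ mcoeffX.
  by rewrite (inj_eq (@mon_inj _ _)) (inj_eq enum_val_inj) (negPf nsr) mulr0.
move=> y [x Fx].
have vq0 : \sum_r v 0 r *: q (enum_val r) = 0.
  apply/mpolyP => m; rewrite mcoeff0 raddf_sum /=.
  have [mB|Bm] := ltnP (mdeg m) (c * D).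
    have mi i : (m i < c * D)%N.
      by apply: leq_ltn_trans mB; rewrite mdegE (bigD1 i) //= leq_addr.
    pose b : colT := [ffun i => Ordinal (mi i)].
    have -> : m = mon _ _ b by apply/mnmP => i; rewrite mnmE ffunE.
    have := congr1 (fun u : 'rV_ _ => u 0 (enum_rank b)) vA.
    rewrite !mxE => vA0; rewrite -[RHS]vA0; apply: eq_bigr => r _.
    by rewrite mcoeffZ mxE enum_rankK.
  apply: big1 => r _; rewrite mcoeffZ memN_msupp_eq0 ?mulr0 //.
  apply: msize_mdeg_ge; apply: leq_trans Bm.
  have aD j : (enum_val r j <= c ^ P)%N by rewrite -ltnS.
  apply: leq_trans (msize_prod_exp Fd aD) _.
  rewrite /D /c; nia.
rewrite raddf_sum -[RHS](meval0 x) -vq0 raddf_sum /=.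
apply: eq_bigr => r _; rewrite !mevalZ mevalX rmorph_prod; congr (_ * _).
by apply: eq_bigr => j _; rewrite mnmE rmorphXn /= Fx.
Qed.

(** * Sets with curves in every direction *)

Lemma meval_homogeneous (K : fieldType) N d (p : {mpoly K[N]})
    (v : 'I_N -> K) t :
  p \is d.-homog -> p.@[fun j => t * v j] = t ^+ d * p.@[v].
Proof.
move/dhomogP=> hom; rewrite !mevalE mulr_sumr big_seq [RHS]big_seq.
apply: eq_bigr => m /hom /= md; rewrite mulrCA; congr (_ * _).
rewrite mdegE in md; rewrite -md -prodrXr -big_split /=.
by apply: eq_bigr => j _; rewrite exprMn.
Qed.

(** If a polynomial vanishes on S, restrict its Taylor expansion at y0 to the
curve with velocity H: the coefficient of lowest order in t is the value at H of
the homogeneous part of lowest degree, which therefore vanishes for every H.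
Only curves of degree two are considered, as these are what a product of two
matrices moving linearly traces out. *)
Lemma velocities_not_thin (K : closedFieldType) N (S : ('I_N -> K) -> Prop) y0 :
  (forall H, exists W, forall t, S (fun j => y0 j + t * (H j + t * W j))) ->
  ~ thin S.
Proof.
move=> curves [g g0 gS].
pose g' := g \mPo [tuple 'X_j + (y0 j)%:MP | j < N].
have g'E y : g'.@[y] = g.@[fun j => y0 j + y j].
  rewrite comp_mpoly_meval; apply: meval_eq => j.
  by rewrite tnth_mktuple mevalD mevalXU mevalC addrC.
have g'0 : g' != 0.
  have [z gz] := mpoly_nonroot g0; apply: contraNneq gz => eg'.
  have := g'E (fun j => z j - y0 j); rewrite eg' meval0 => ->.
  by apply/eqP; apply: meval_eq => j; rewrite addrC subrK.
pose L := msize g'.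
have g'_sum : g' = \sum_(d < L) pihomog mdeg d g' by apply: pihomog_partitionE.
have ex_part : exists d, (fun d => pihomog mdeg d g' != 0) d.
  have [/forallP all0|] := boolP [forall d : 'I_L, pihomog mdeg d g' == 0].
    by case/eqP: g'0; rewrite g'_sum big1 // => d _; apply/eqP.
  by rewrite negb_forall => /existsP[d nz]; exists (nat_of_ord d).
case: (ex_minnP ex_part) => e ge_neq0 e_min.
have [H] := mpoly_nonroot ge_neq0; case/negP.
have [W SW] := curves H.
pose h j : {poly K} := (H j)%:P + 'X * (W j)%:P.
have hE t j : (h j).[t] = H j + t * W j by rewrite /h !hornerE.
pose part d := mmap (@polyC K) h (pihomog mdeg d g').
have partE d t : t ^+ d * (part d).[t] =
    (pihomog mdeg d g').@[fun j => t * (H j + t * W j)].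
  rewrite horner_mmap -meval_homogeneous; last exact: pihomogP.
  by apply: meval_eq => j; rewrite hE.
(* The restriction of g' to the curve, divided by its lowest power of t. *)
pose Q : {poly K} := \sum_(d < L | (e <= d)%N) 'X^(d - e) * part d.
have XQ_root t : t ^+ e * Q.[t] = 0.
  rewrite -(gS _ (SW t)) -g'E g'_sum raddf_sum /= horner_sum mulr_sumr.
  rewrite [RHS](bigID (fun d : 'I_L => (e <= d)%N)) /= [X in _ + X]big1 ?addr0.
    apply: eq_bigr => d ed; rewrite -partE hornerM hornerXn mulrA -exprD.
    by rewrite subnKC.
  move=> d; rewrite -ltnNge => de.
  suff /eqP-> : pihomog mdeg d g' == 0 by rewrite meval0.
  by apply: contraLR de => /e_min; rewrite -leqNgt.
have Q0 : Q = 0.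
  apply/eqP; apply: contraT => Qn0.
  have : 'X^e * Q != 0 by rewrite mulf_neq0 // -size_poly_eq0 size_polyXn.
  case/closed_nonrootP => t; rewrite /root hornerM hornerXn XQ_root.
  by rewrite eqxx.
have eL : (e < L)%N.
  rewrite ltnNge; apply: contraNN ge_neq0 => Le; rewrite g'_sum raddf_sum /=.
  rewrite big1 // => d _; apply: pihomog_ne0 (pihomogP _ _ _).
  by rewrite neq_ltn (leq_trans (ltn_ord d) Le).
have := congr1 (fun r => r.[0]) Q0; rewrite /Q horner0 horner_sum.
rewrite (bigD1 (Ordinal eL)) //= subnn expr0 mul1r big1 ?addr0.
  rewrite horner_mmap => <-; apply/eqP/meval_eq => j.
  by rewrite hE mul0r addr0.
move=> d /andP[ed ned]; rewrite hornerM hornerXn expr0n subn_eq0.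
suff /negPf-> : ~~ (d <= e)%N by rewrite mul0r.
by apply: contra ned => de; apply/eqP/val_inj/eqP; rewrite /= eqn_leq de.
Qed.

(** * Generic completion ranks *)

(** Coordinates are numbered as in the definition of Zariski-open sets. *)
Definition to_partial (K : fieldType) m n (E : {set 'I_m * 'I_n})
  (y : 'I_#|edge E| -> K) : partial_matrix K E := [ffun e => y (enum_rank e)].

Lemma completion_to_partial (K : fieldType) m n (E : {set 'I_m * 'I_n})
    (y : 'I_#|edge E| -> K) (A : 'M_(m, n)) :
  completion (to_partial y) A <->
  forall j, A (val (enum_val j)).1 (val (enum_val j)).2 = y j.
Proof.
split=> [cA j|Ay e]; first by rewrite cA ffunE enum_valK.
by rewrite ffunE -Ay enum_rankK.
Qed.

Lemma is_completion_rank_uniq (K : fieldType) m n (E : {set 'I_m * 'I_n})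
    (M : partial_matrix K E) r s :
  is_completion_rank M r -> is_completion_rank M s -> r = s.
Proof.
move=> [[A [cA <-]] minA] [[B [cB <-]] minB].
by apply/eqP; rewrite eqn_leq minA // minB.
Qed.

(** Uniqueness rests on irreducibility of affine space: the product of two
nonzero polynomials has a nonvanishing point, and the partial matrix there has
only one completion rank. *)
Lemma generic_completion_rank_of_thin_failures (K : closedFieldType) m n
    (E : {set 'I_m * 'I_n}) r :
  thin (fun y => ~ is_completion_rank (to_partial y : partial_matrix K E) r) ->
  is_generic_completion_rank K E r.
Proof.
case=> g g0 gr.
have good (M : partial_matrix K E) :
    g.@[fun i => M (enum_val i)] != 0 -> is_completion_rank M r.
  move=> /eqP gM; apply: boolp.contrapT => nM; apply: gM; apply: gr.
  suff -> : to_partial (fun i => M (enum_val i)) = M by [].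
  by apply/ffunP => e; rewrite ffunE enum_rankK.
split.
  exists (fun M => g.@[fun i => M (enum_val i)] != 0); split=> //.
    exists (fun p => p = g) => M; split=> [gM|[_ -> //]]; first by exists g.
  have [y gy] := mpoly_nonroot g0; exists (to_partial y).
  by congr (_ != 0): gy; apply: meval_eq => j; rewrite ffunE enum_valK.
move=> s [U [[F UP] [M0 UM0] Us]].
have [p Fp pM0] := iffLR (UP M0) UM0.
have p0 : p != 0 by apply: contraNneq pM0 => ->; rewrite meval0.
have [y] := mpoly_nonroot (mulf_neq0 g0 p0).
rewrite mevalM mulf_eq0 negb_or => /andP[gy py].
have yE q : q.@[fun i => to_partial y (enum_val i)] = q.@[y].
  by apply: meval_eq => j; rewrite ffunE enum_valK.
apply: (@is_completion_rank_uniq _ _ _ _ (to_partial y)).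
  by apply: good; rewrite yE.
by apply: Us; apply/UP; exists p; rewrite ?yE.
Qed.

Lemma card_edge m n (E : {set 'I_m * 'I_n}) : #|edge E| = #|E|.
Proof. by rewrite card_sig; apply: eq_card => e; rewrite inE. Qed.

(** The rank-s matrices have dimension (m - s) s + s n: once s independent rows
are fixed, the other m - s rows are determined by their s coefficients on
these.  Normalising the coefficient matrix to be the identity on the chosen
rows is what keeps the parameter count that low. *)
Lemma thin_completions_of_rank (K : fieldType) m n (E : {set 'I_m * 'I_n}) s :
  ((m - s) * s + s * n < #|E|)%N ->
  thin (fun y => exists A : 'M[K]_(m, n),
    completion (to_partial y : partial_matrix K E) A /\ \rank A = s).
Proof.
rewrite -card_edge => few.
pose spanned (f : {f : {ffun 'I_s -> 'I_m} | injectiveb f}) y :=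
  exists2 A : 'M[K]_(m, n), completion (to_partial y : partial_matrix K E) A &
    exists2 D : 'M_(m, s), rowsub (val f) D = 1%:M & A = D *m rowsub (val f) A.
apply: (@thin_sub _ _ _ (fun y => exists f, spanned f y)); last first.
  move=> y [A [cA rA]].
  have [f injf AD] : exists2 f : {ffun 'I_s -> 'I_m}, injectiveb f &
      exists2 D : 'M_(m, s), rowsub f D = 1%:M & A = D *m rowsub f A.
    rewrite -rA; exists (maxrankfun A); first exact/injectiveP/maxrankfun_inj.
    have /submxP[D DA] : (A <= rowsub (maxrankfun A) A)%MS.
      by rewrite eq_maxrowsub.
    exists D => //; apply: (row_free_inj (maxrowsub_free A)).
    by rewrite /= mul1mx mul_rowsub_mx -DA.
  by exists (Sub f injf), A.
apply: thin_exists => -[f inj_f]; have /injectiveP injf := inj_f.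
rewrite /spanned /= {spanned inj_f}.
pose other := {i : 'I_m | i \notin codom f}.
pose par : finType := (other * 'I_s + 'I_s * 'I_n)%type.
(* The coefficients are constants on the chosen rows, parameters elsewhere. *)
pose coef i c : {mpoly K[#|par|]} :=
  if insub i is Some u then 'X_(enum_rank (inl (u : other, c) : par))
  else (f c == i)%:R.
pose F (j : 'I_#|edge E|) : {mpoly K[#|par|]} := let e := val (enum_val j) in
  \sum_c coef e.1 c * 'X_(enum_rank (inr (c, e.2) : par)).
have card_par : (#|par| < #|edge E|)%N.
  rewrite card_sum !card_prod !card_ord.
  suff -> : #|{: other}| = (m - s)%N by [].
  rewrite card_sig -[m in (m - _)%N]card_ord -(cardC (mem (codom f))).
  by rewrite card_codom // card_ord addKn; apply: eq_card.
apply: thin_sub (thin_image_few_params F card_par) _ => y [A cA [D D1 AD]].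
pose x (u : par) := match u with
  | inl (i, c) => D (val i) c
  | inr (c, j) => A (f c) j end.
exists (fun i => x (enum_val i)) => j.
move/completion_to_partial: cA => <-; rewrite /F /=.
case: (val (enum_val j)) => a b /=.
rewrite raddf_sum /= [in RHS]AD mxE; apply: eq_bigr => c _.
rewrite mevalM mevalXU enum_rankK mxE /=; congr (_ * _).
rewrite /coef; case: insubP => [u _ <-|]; first by rewrite mevalXU enum_rankK.
rewrite negbK => /codomP[c' ->]; rewrite (inj_eq injf) rmorph_nat.
by have := congr1 (fun B : 'M_s => B c' c) D1; rewrite !mxE eq_sym => ->.
Qed.

Lemma mxrank_le_factor (K : fieldType) m n r (A : 'M[K]_(m, n)) :
  (\rank A <= r)%N <-> exists (P : 'M_(m, r)) (Q : 'M_(r, n)), A = P *m Q.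
Proof.
split=> [rA|[P [Q ->]]]; last first.
  exact: leq_trans (mxrankM_maxl _ _) (rank_leq_col _).
rewrite -(subnKC rA); exists (row_mx (col_base A) 0), (col_mx (row_base A) 0).
by rewrite mul_row_col mulmx0 addr0 mulmx_base.
Qed.

Definition completable (K : fieldType) m n (E : {set 'I_m * 'I_n}) r
    (y : 'I_#|edge E| -> K) : Prop :=
  exists2 A : 'M_(m, n), completion (to_partial y) A & (\rank A <= r)%N.

(** Matrices of rank at most r are the image of the polynomial map
(P, Q) |-> P *m Q with inner dimension r. *)
Lemma completable_thin_or_cothin (K : closedFieldType) m n
    (E : {set 'I_m * 'I_n}) r :
  thin (fun y : 'I_#|edge E| -> K => completable r y) \/
  thin (fun y : 'I_#|edge E| -> K => ~ completable r y).
Proof.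
pose par : finType := ('I_m * 'I_r + 'I_r * 'I_n)%type.
pose F (j : 'I_#|edge E|) : {mpoly K[#|par|]} := let e := val (enum_val j) in
  \sum_c 'X_(enum_rank (inl (e.1, c) : par)) *
         'X_(enum_rank (inr (c, e.2) : par)).
pose image y := exists x, forall j, (F j).@[x] = y j.
have imageP y : completable r y <-> image y.
  split=> [[A cA /mxrank_le_factor[P [Q APQ]]]|[x Fx]].
    pose x (u : par) :=
      match u with inl (i, c) => P i c | inr (c, j) => Q c j end.
    exists (fun i => x (enum_val i)) => j.
    move/completion_to_partial: cA => <-.
    rewrite APQ mxE raddf_sum; apply: eq_bigr => c _.
    by rewrite /= mevalM !mevalXU !enum_rankK.
  exists ((\matrix_(i, c) x (enum_rank (inl (i, c) : par))) *m
          (\matrix_(c, j) x (enum_rank (inr (c, j) : par)))).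
    apply/completion_to_partial => j.
    rewrite mxE -Fx raddf_sum; apply: eq_bigr => c _.
    by rewrite /= mevalM !mevalXU !mxE.
  by apply/mxrank_le_factor; do 2!eexists.
have [h|h] := image_thin_or_cothin F; [left|right].
  by refine (thin_sub h _) => y /imageP.
by refine (thin_sub h _) => y nc /imageP.
Qed.

(** * Tangent directions to the determinantal variety *)

(** With a section S of L, the matrix 1 - S L is the projector onto the right
kernel of L, which has dimension n - k. *)
Lemma kernel_factor (K : fieldType) k n (L : 'M[K]_(k, n)) S :
  L *m S = 1%:M -> exists (P : 'M_(n, n - k)) (P' : 'M_(n - k, n)),
    P *m P' = 1%:M - S *m L.
Proof.
move=> LS; suff /mxrank_le_factor[P [P' PP']] :
    (\rank (1%:M - S *m L)%R <= n - k)%N by exists P, P'.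
have rL : (k <= \rank L)%N by rewrite -{1}(mxrank1 K k) -LS mxrankM_maxl.
apply: leq_trans (leq_sub2l n rL); rewrite leq_subRL ?rank_leq_col //.
by apply: mulmx0_rank_max; rewrite mulmxBr mulmx1 mulmxA LS mul1mx subrr.
Qed.

(** With the projectors 1 - S L = P P' and 1 - R T = Q' Q, split
X = (1 - S L) X + S L X: the first term is P times P' X, and the second equals
S L X (1 - R T) as L X R = 0, hence is S L X Q' times Q.  The conclusion says
that X is the velocity at P *m Q of a product of moving factors. *)
Lemma tangent_decomposition (K : fieldType) k n (L : 'M[K]_(k, n))
    (R : 'M[K]_(n, k)) S T :
  L *m S = 1%:M -> T *m R = 1%:M ->
  exists (P : 'M[K]_(n, n - k)) (Q : 'M[K]_(n - k, n)), forall X : 'M_n,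
    L *m X *m R = 0 -> exists P1 Q1, X = P *m Q1 + P1 *m Q.
Proof.
move=> LS TR; have [P [P' PP']] := kernel_factor LS.
have [Q' [Q QQ']] : exists (Q' : 'M_(n, n - k)) (Q : 'M_(n - k, n)),
    Q' *m Q = 1%:M - R *m T.
  have [|Q [Q' QQ']] := @kernel_factor _ _ _ R^T T^T.
    by rewrite -trmx_mul TR trmx1.
  by exists Q'^T, Q^T; rewrite -trmx_mul QQ' raddfB /= trmx1 trmx_mul !trmxK.
exists P, Q => X LXR; exists (S *m L *m X *m Q'), (P' *m X).
rewrite mulmxA PP' -mulmxA QQ' mulmxBl mul1mx mulmxBr mulmx1.
by rewrite [_ *m (R *m T)]mulmxA -!(mulmxA S) LXR mul0mx mulmx0 subr0 subrK.
Qed.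

(** The single unspecified position of each block absorbs the sum of the
prescribed entries of that block, which makes all block sums vanish; so every
direction H on the specified positions is the restriction of a tangent
direction at P *m Q. *)
Lemma completable_not_thin (K : closedFieldType) n k (E : {set 'I_n * 'I_n})
    (a b : 'I_n -> 'I_k) :
  (forall c d, #|[set e in ~: E | (a e.1 == c) && (b e.2 == d)]| = 1)%N ->
  ~ thin (fun y : 'I_#|edge E| -> K => completable (n - k) y).
Proof.
move=> block1.
have block_ex c d : exists e, [&& e \notin E, a e.1 == c & b e.2 == d].
  have /card_gt0P[e] :
      (0 < #|[set e in ~: E | (a e.1 == c) && (b e.2 == d)]|)%N.
    by rewrite block1.
  by rewrite !inE => ?; exists e.
have /fin_all_exists[sa saP] c : exists i, a i = c.
  by have [e /and3P[_ /eqP]] := block_ex c c; exists e.1.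
have /fin_all_exists[sb sbP] d : exists j, b j = d.
  by have [e /and3P[_ _ /eqP]] := block_ex d d; exists e.2.
pose L : 'M[K]_(k, n) := \matrix_(c, i) (a i == c)%:R.
pose R : 'M[K]_(n, k) := \matrix_(j, d) (b j == d)%:R.
pose S : 'M[K]_(n, k) := \matrix_(i, c) (i == sa c)%:R.
pose T : 'M[K]_(k, n) := \matrix_(d, j) (j == sb d)%:R.
have LS : L *m S = 1%:M.
  apply/matrixP => c c'; rewrite !mxE (bigD1 (sa c')) //= big1.
    by rewrite !mxE saP eqxx mulr1 addr0 eq_sym.
  by move=> i /negPf ni; rewrite !mxE ni mulr0.
have TR : T *m R = 1%:M.
  apply/matrixP => d d'; rewrite !mxE (bigD1 (sb d)) //= big1.
    by rewrite !mxE sbP eqxx mul1r addr0.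
  by move=> i /negPf ni; rewrite !mxE ni mul0r.
have [P [Q tangent]] := tangent_decomposition LS TR.
pose at_edge (A : 'M[K]_n) (j : 'I_#|edge E|) :=
  A (val (enum_val j)).1 (val (enum_val j)).2.
apply: (@velocities_not_thin _ _ _ (at_edge (P *m Q))) => H.
pose h e : K := if insub e is Some u then H (enum_rank (u : edge E)) else 0.
pose block_sum c d := \sum_(e in E | (a e.1 == c) && (b e.2 == d)) h e.
pose X : 'M[K]_n := \matrix_(i, j)
  if (i, j) \in E then h (i, j) else - block_sum (a i) (b j).
have XH j : at_edge X j = H j.
  rewrite /at_edge mxE -surjective_pairing (valP (enum_val j)) /h.
  by rewrite valK enum_valK.
have LXR : L *m X *m R = 0.
  apply/matrixP => c d; rewrite !mxE.
  transitivity (\sum_(e | (a e.1 == c) && (b e.2 == d)) X e.1 e.2).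
    transitivity (\sum_j \sum_i (a i == c)%:R * X i j * (b j == d)%:R).
      apply: eq_bigr => j _; rewrite !mxE mulr_suml.
      by apply: eq_bigr => i _; rewrite mxE.
    rewrite exchange_big pair_big big_mkcond [RHS]big_mkcond /=.
    apply: eq_bigr => -[i j] _ /=.
    by do 2![case: eqP => _]; rewrite ?mulr1 ?mul1r ?mul0r ?mulr0.
  rewrite (bigID (mem E)) /=.
  have -> : \sum_(e | (a e.1 == c) && (b e.2 == d) && (e \in E)) X e.1 e.2 =
            block_sum c d.
    rewrite /block_sum; apply: eq_big => [e|e /andP[_ eE]].
      by rewrite andbC.
    by rewrite mxE -surjective_pairing eE.
  rewrite (eq_bigr (fun=> - block_sum c d)); last first.
    move=> e /andP[/andP[/eqP <- /eqP <-] /negPf neE].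
    by rewrite mxE -surjective_pairing neE.
  rewrite sumr_const (_ : #|_| = 1)%N ?subrr // -(block1 c d).
  by apply: eq_card => e; rewrite !inE andbC.
have [P1 [Q1 XE]] := tangent X LXR.
exists (at_edge (P1 *m Q1)) => t.
exists ((P + t *: P1) *m (Q + t *: Q1)).
  apply/completion_to_partial => j; rewrite -[LHS]/(at_edge _ j) -XH XE.
  rewrite mulmxDl !mulmxDr -!scalemxAl -!scalemxAr /at_edge !mxE.
  ring.
by apply/mxrank_le_factor; do 2!eexists.
Qed.

(** * The circulant pattern *)

Lemma addn_modn_onto X m r : (r < m)%N ->
  exists2 s, (s < m)%N & ((X + s) %% m = r)%N.
Proof.
move=> rm; have m_gt0 : (0 < m)%N := leq_ltn_trans (leq0n r) rm.
exists ((r + (m - X %% m)) %% m)%N; first by rewrite ltn_mod.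
rewrite modnDmr -modnDml addnCA subnKC ?(ltnW (ltn_pmod _ _)) //.
by rewrite modnDr modn_small.
Qed.

Lemma mem_Gnl_compl n l (e : 'I_n * 'I_n) :
  (e \in ~: Gnl n l) =
  [exists t : 'I_(n - l), e.2 == ((e.1 + t) %% n)%N :> nat].
Proof. by rewrite !inE negbK. Qed.

Lemma card_Gnl_compl n l : (#|~: Gnl n l| <= n * (n - l))%N.
Proof.
case: n => [|n].
  by rewrite (leq_trans (max_card _)) // card_prod card_ord.
pose edge_of (p : 'I_n.+1 * 'I_(n.+1 - l)) : 'I_n.+1 * 'I_n.+1 :=
  (p.1, inord ((p.1 + p.2) %% n.+1)).
have sub : ~: Gnl n.+1 l \subset [set edge_of p | p in setT].
  apply/subsetP => -[i j]; rewrite mem_Gnl_compl => /existsP[t /eqP /= jE].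
  apply/imsetP; exists (i, t) => //; congr (_, _).
  by apply: val_inj; rewrite /= inordK // ltn_mod.
apply: leq_trans (subset_leq_card sub) _.
apply: leq_trans (leq_imset_card _ _) _.
by rewrite cardsT card_prod !card_ord.
Qed.

(** Take a(i) = i mod k and b(j) = d * floor(j / k) + j mod d.  The rows of a
class of a are c + k s for s < m, and their unspecified columns are c + t + k s
for t < d.  As d divides k, the residue of the column modulo d depends on t only
and takes each value once; given t, the quotient of the column by k runs once
through the residues modulo m when s does.  So every block contains an
unspecified position, and as there are no more positions than blocks, each
block contains exactly one. *)
Lemma Gnl_blocks m d (k := (m * d)%N) (n := (k * m)%N) l :
  (0 < m)%N -> (0 < d)%N -> (n - l = d)%N ->
  exists a b : 'I_n -> 'I_k, forall c c',
    (#|[set e in ~: Gnl n l | (a e.1 == c) && (b e.2 == c')]| = 1)%N.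
Proof.
move=> m0 d0 nl; have k0 : (0 < k)%N by rewrite muln_gt0 m0.
have ltb (j : 'I_n) : (j %/ k * d + j %% d < k)%N.
  have jm : (j %/ k < m)%N by rewrite ltn_divLR // mulnC.
  have jd : (j %% d < d)%N by rewrite ltn_mod.
  apply: (@leq_trans ((j %/ k).+1 * d)); first by rewrite mulSn addnC ltn_add2r.
  by rewrite leq_mul2r jm orbT.
pose a (i : 'I_n) : 'I_k := Ordinal (ltn_pmod i k0).
pose b (j : 'I_n) : 'I_k := Ordinal (ltb j).
pose block (p : 'I_k * 'I_k) :=
  [set e in ~: Gnl n l | (a e.1 == p.1) && (b e.2 == p.2)].
have onto p : (0 < #|block p|)%N.
  case: p => c c'; apply/card_gt0P.
  have [t ltd tP] := addn_modn_onto c (ltn_pmod c' d0).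
  have c'm : (c' %/ d < m)%N by rewrite ltn_divLR.
  have [s ltm sP] := addn_modn_onto ((c + t) %/ k) c'm.
  have lti : (c + k * s < n)%N.
    apply: (@leq_trans (k * s.+1)); first by rewrite mulnS ltn_add2r.
    by rewrite leq_mul2l ltm orbT.
  have n0 : (0 < n)%N by apply: leq_ltn_trans lti.
  pose i := Ordinal lti; pose j := Ordinal (ltn_pmod (i + t) n0).
  have jE : ((c + k * s + t) %% n = k * (c' %/ d) + (c + t) %% k)%N.
    rewrite -addnA (addnC (k * s)%N) addnA {1}(divn_eq (c + t) k).
    rewrite addnAC (mulnC k s) -mulnDl.
    rewrite (divn_eq ((c + t) %/ k + s) m) sP mulnDl -mulnA (mulnC m k).
    rewrite -addnA modnMDl modn_small mulnC //.
    apply: (@leq_trans (k * (c' %/ d).+1)).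
      by rewrite mulnS addnC ltn_add2r ltn_mod.
    by rewrite leq_mul2l c'm orbT.
  exists (i, j); rewrite !inE negbK; apply/and3P; split.
  - by rewrite nl; apply/existsP; exists (Ordinal ltd).
  - by apply/eqP/val_inj; rewrite /= addnC [(k * s)%N]mulnC modnMDl modn_small.
  apply/eqP/val_inj; rewrite /= jE.
  rewrite (mulnC k) divnMDl // (divn_small (ltn_pmod _ k0)) addn0.
  rewrite -modnDm (eqP (dvdn_mull _ (dvdn_mull m (dvdnn d)))) add0n modn_mod.
  by rewrite modn_dvdm ?dvdn_mull // tP -divn_eq.
have sum_blocks : (\sum_p #|block p| = #|~: Gnl n l|)%N.
  rewrite -sum1_card (partition_big (fun e => (a e.1, b e.2)) predT) //=.
  apply: eq_bigr => p _; rewrite -sum1_card; apply: eq_bigl => e.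
  by rewrite inE.
have all1 : [forall p, 1%N == #|block p|].
  have eqif p : (1 <= #|block p| ?= iff (1%N == #|block p|))%N.
    by split.
  have := leqif_sum (fun p (_ : predT p) => eqif p).
  rewrite sum_blocks sum1_card card_prod !card_ord => -[le1 <-].
  rewrite eqn_leq le1 /=; apply: leq_trans (card_Gnl_compl _ _) _.
  by rewrite nl /n -mulnA.
by exists a, b => c c'; have /forallP/(_ (c, c'))/eqP := all1.
Qed.

(** A rank s < n - k is generically excluded since
n^2 - (n - s)^2 < n^2 - k^2, and the blocks make n - k generically
attainable. *)
Lemma generic_completion_rank_of_blocks (K : closedFieldType) n k
    (E : {set 'I_n * 'I_n}) (a b : 'I_n -> 'I_k) :
  (#|~: E| <= k ^ 2)%N ->
  (forall c d, #|[set e in ~: E | (a e.1 == c) && (b e.2 == d)]| = 1)%N ->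
  is_generic_completion_rank K E (n - k).
Proof.
move=> few block1; apply: generic_completion_rank_of_thin_failures.
have [/(completable_not_thin block1) //|upper] :=
  @completable_thin_or_cothin K _ _ E (n - k).
have lower (s : 'I_(n - k)) : thin (fun y => exists A : 'M[K]_n,
    completion (to_partial y : partial_matrix K E) A /\ \rank A = s).
  apply: thin_completions_of_rank.
  have := cardsC E; rewrite card_prod !card_ord.
  have := ltn_ord s; move: (nat_of_ord s) #|E| #|~: E| few => u x y; nia.
refine (thin_sub (thin_or upper (thin_exists lower)) _) => y not_rank.
apply: boolp.contrapT => /boolp.not_orP[/boolp.contrapT[A cA rA] no_lower].
have minimal B : completion (to_partial y) B -> (n - k <= \rank B)%N.
  move=> cB; rewrite leqNgt; apply/negP => small; apply: no_lower.
  by exists (Ordinal small), B.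
apply: not_rank; split=> //; exists A; split=> //.
by apply/eqP; rewrite eqn_leq rA minimal.
Qed.

Theorem proposition5p4 (R : realType) (n k l : nat)
  (hn : (0 < n)%N) (hk : (0 < k)%N)
  (hkn : (k %| n)%N) (hnk : (n %| k ^ 2)%N)
  (hl : l = (n - k ^ 2 %/ n)%N) :
  is_generic_completion_rank (complex R) (Gnl n l) (n - k)%N /\
  n%:R - Num.sqrt (n%:R ^+ 2 - n%:R * l%:R) = (n - k)%N%:R :> R.
Proof.
have [m nE] : exists m, n = (k * m)%N.
  by case/dvdnP: hkn => m ->; exists m; rewrite mulnC.
have [d kE] : exists d, k = (m * d)%N.
  move: hnk; rewrite nE -mulnn dvdn_pmul2l // => /dvdnP[d ->].
  by exists d; rewrite mulnC.
have m0 : (0 < m)%N by move: hn; rewrite nE muln_gt0 => /andP[].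
have d0 : (0 < d)%N by move: hk; rewrite kE muln_gt0 => /andP[].
have quot : (k ^ 2 %/ n = d)%N.
  by rewrite nE -mulnn divnMl // kE mulKn.
have dn : (d <= n)%N by rewrite nE kE mulnAC leq_pmull // muln_gt0 m0.
have nd : (n * d = k ^ 2)%N by rewrite nE -mulnA -kE.
have nl : (n - l = d)%N by rewrite hl quot subKn.
have kn : (k <= n)%N by rewrite dvdn_leq.
split.
  have [a [b block1]] : exists a b : 'I_n -> 'I_k, forall c c',
      (#|[set e in ~: Gnl n l | (a e.1 == c) && (b e.2 == c')]| = 1)%N.
    by move: nl; clear -m0 d0 nE kE; subst n k; apply: Gnl_blocks.
  apply: generic_completion_rank_of_blocks block1 => //.
  by rewrite -nd -nl card_Gnl_compl.
have -> : n%:R ^+ 2 - n%:R * l%:R = k%:R ^+ 2 :> R.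
  rewrite expr2 -mulrBr -natrB; last by rewrite hl leq_subr.
  by rewrite nl -natrM nd natrX.
by rewrite sqrtr_sqr ger0_norm ?ler0n // natrB.
Qed.
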